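(* Let $k\ge1$ be fixed and let $\boldsymbol\beta=(\beta_1,\ldots,\beta_k)$ be constants with $\beta_i>0$ and $\beta_1+\cdots+\beta_k=1$. Color the vertices of $[n]$ so that the color class $V_i=\{v:c(v)=i\}$ has $|V_i|=\beta_i n$ for each $i\in[k]$. Let $\mathbf{c}=(c_1,\ldots,c_n)\in[k]^n$ be an arbitrary sequence of colors in which each color $j$ appears exactly $\beta_j n$ times. Let $q\ge n$. There is $K=K(\boldsymbol\beta)$ such that if $p=K\log n/n$ and, in addition, each edge of $G_{n,p}$ is independently given a uniformly random color from $[q]$, then with probability tending to $1$ as $n\to\infty$, $G_{n,p}$ contains a $\mathbf{c}$-colored rainbow Hamilton cycle.
   Context: $G_{n,p}$ is the random graph on vertex set $[n]$ in which each of the $\binom n2$ possible edges is present independently with probability $p$. A Hamilton cycle $H=(x_1,x_2,\ldots,x_n,x_1)$, viewed as a sequence of vertices, is $\mathbf{c}$-colored if $c(x_i)=c_i$ for $i=1,\ldots,n$ (vertex colors). It is rainbow if its $n$ edges all receive distinct edge colors. *)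

(* Defs.v *)
From HB Require Import structures.
From mathcomp Require Import all_boot all_order all_algebra.
From mathcomp Require Import reals exp.

Set Implicit Arguments.
Unset Strict Implicit.
Unset Printing Implicit Defensive.

Import Order.TTheory GRing.Theory Num.Theory.
Local Open Scope ring_scope.

Definition edge (n : nat) := {e : {set 'I_n} | #|e| == 2%N}.

Definition adj (n : nat) (E : {set edge n}) : rel 'I_n :=
  fun u v => [exists e in E, val e == [set u; v]].

(* As [x] is an n-tuple of vertices of an n-vertex graph, being duplicate-free
   makes the cycle spanning. For n = 2 the "cycle" would use one edge twice. *)
Definition hamilton_cycle (n : nat) (E : {set edge n}) (x : n.-tuple 'I_n)
    : bool :=
  (2 < n)%N && ucycleb (adj E) x.

Definition cycle_edges (n : nat) (x : n.-tuple 'I_n) : {set edge n} :=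
  [set e | [exists v : 'I_n, (v \in x) && (val e == [set v; next x v])]].

Definition vertex_colored (n k : nat) (c : 'I_n -> 'I_k)
    (cs : n.-tuple 'I_k) (x : n.-tuple 'I_n) : bool :=
  [seq c v | v <- x] == cs :> seq 'I_k.

Definition rainbow (n q : nat) (f : {ffun edge n -> 'I_q})
    (x : n.-tuple 'I_n) : bool :=
  dinjectiveb f (mem (cycle_edges x)).

(* An outcome is a graph together with a color for every potential edge; the
   colors of absent edges are drawn too, but no event below looks at them. *)
Definition outcome (n q : nat) : finType :=
  ({set edge n} * {ffun edge n -> 'I_q})%type.

Definition has_colored_rainbow_hamilton (n k q : nat) (c : 'I_n -> 'I_k)
    (cs : n.-tuple 'I_k) : pred (outcome n q) :=
  fun w => [exists x : n.-tuple 'I_n,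
    [&& hamilton_cycle w.1 x, vertex_colored c cs x & rainbow w.2 x]].

Definition gnp_law (R : realType) (n : nat) (p : R) (E : {set edge n}) : R :=
  \prod_(e : edge n) (if e \in E then p else 1 - p).

Definition coloring_law (R : realType) (n q : nat)
    (f : {ffun edge n -> 'I_q}) : R :=
  \prod_(e : edge n) q%:R^-1.

(* A probability when 0 <= p <= 1 and 0 < q. *)
Definition Pr (R : realType) (n q : nat) (p : R) (A : pred (outcome n q)) : R :=
  \sum_(w | A w) gnp_law p w.1 * coloring_law R w.2.

(* Main.v *)
Require Import Defs.
From HB Require Import structures.
From mathcomp Require Import all_boot all_order all_algebra.
From mathcomp Require Import reals exp.
From mathcomp Require Import perm sequences.
From mathcomp Require Import ring lra zify.

(* A vertex-colored rainbow Hamilton cycle is a hyperedge on the ground set of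
   pairs (edge, color). The uniform measure on these hyperedges is kappa-spread
   with kappa of order n q: fixing one cycle containing a set U of pairs, the
   placements of the vertices along another such cycle are counted by exposing
   the vertices in the order of the first one, where a vertex whose predecessor
   edge lies in U has only 2 possible positions.
   The spread lemma (Frankston-Kahn-Narayanan-Park) then produces a hyperedge in
   a binomial random set. It is proved with the minimum fragments of Park and
   Pham: a fragment T of a hyperedge relative to W is contained in every
   hyperedge included in W u T, so W u T and a subset of one canonical
   hyperedge determine it. Each round of density 16 / kappa halves the fragments
   until their size is bounded, and one last round of density of order
   log n / kappa covers them.
   Finally, giving each edge at most one color instead of independent palettes
   only helps, by McDiarmid's blockwise comparison. *)

Set Implicit Arguments.
Unset Strict Implicit.
Unset Printing Implicit Defensive.

Import Order.TTheory GRing.Theory Num.Theory.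
Local Open Scope ring_scope.

(** * Product measures *)

Definition upd (X Z : finType) (w : {ffun X -> Z}) (x : X) (z : Z) :
  {ffun X -> Z} := [ffun y => if y == x then z else w y].

(** Pushforward of a product measure: the fibre of a coordinatewise map is a product of fibres, so
    its mass factorizes. *)
Lemma sum_prod_comp (R : comNzRingType) (X Y Z : finType) (g : Y -> Z)
    (nu : Y -> R) (F : {ffun X -> Z} -> R) :
  \sum_(w : {ffun X -> Y}) (\prod_x nu (w x)) * F [ffun x => g (w x)] =
  \sum_(z : {ffun X -> Z}) (\prod_x \sum_(y | g y == z x) nu y) * F z.
Proof.
rewrite (partition_big (fun w : {ffun X -> Y} => [ffun x => g (w x)]) predT) //=.
apply: eq_bigr => z _; rewrite bigA_distr_big_dep /= mulr_suml.
apply: eq_big => [w | w /eqP -> //].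
apply/eqP/familyP => [<- x | wz]; first by rewrite unfold_in ffunE /= eqxx.
by apply/ffunP => x; rewrite ffunE; apply/eqP/wz.
Qed.

(** Integrates out the coordinate [x0] first. The value [z0] only picks one representative of each
    class of functions that agree off [x0]. *)
Lemma sum_prod_split (R : comNzRingType) (X Z : finType) (x0 : X) (z0 : Z)
    (mu : X -> Z -> R) (F : {ffun X -> Z} -> R) :
  \sum_(w : {ffun X -> Z}) (\prod_x mu x (w x)) * F w =
  \sum_(w : {ffun X -> Z} | w x0 == z0)
    (\prod_(x | x != x0) mu x (w x)) * \sum_z mu x0 z * F (upd w x0 z).
Proof.
under [RHS]eq_bigr do rewrite mulr_sumr.
rewrite pair_big_dep /=.
rewrite (reindex_onto (fun u : {ffun X -> Z} * Z => upd u.1 x0 u.2)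
  (fun w => (upd w x0 z0, w x0))) /=; last first.
  by move=> w _; apply/ffunP => x; rewrite !ffunE; case: eqP => // ->.
apply: eq_big => [[w z] | [w z] _] /=.
  rewrite xpair_eqE !ffunE !eqxx !andbT; apply/eqP/eqP => [<- | wz].
    by rewrite ffunE eqxx.
  by apply/ffunP => x; rewrite !ffunE; case: eqP => // ->.
rewrite (bigD1 x0) //= ffunE eqxx mulrCA !mulrA; congr (_ * _).
by congr (_ * _); apply: eq_bigr => x /negbTE xx0; rewrite ffunE xx0.
Qed.

(** Hybrid argument: the law is switched from [nu1] to [nu2] one coordinate at a time, with all
    other coordinates frozen. *)
Lemma ler_sum_prod (R : realDomainType) (X Z : finType) (z0 : Z)
    (nu1 nu2 : Z -> R) (F : {ffun X -> Z} -> R) :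
  (forall z, 0 <= nu1 z) -> (forall z, 0 <= nu2 z) ->
  (forall x w, \sum_z nu1 z * F (upd w x z) <= \sum_z nu2 z * F (upd w x z)) ->
  \sum_(w : {ffun X -> Z}) (\prod_x nu1 (w x)) * F w <=
  \sum_(w : {ffun X -> Z}) (\prod_x nu2 (w x)) * F w.
Proof.
move=> nu1_ge0 nu2_ge0 nu12.
pose mu (s : seq X) x := if x \in s then nu2 else nu1.
have mu_ge0 s x z : 0 <= mu s x z by rewrite /mu; case: ifP.
suff hyb s : uniq s -> \sum_(w : {ffun X -> Z}) (\prod_x nu1 (w x)) * F w <=
    \sum_(w : {ffun X -> Z}) (\prod_x mu s x (w x)) * F w.
  have := hyb (enum X) (enum_uniq _); congr (_ <= _).
  apply: eq_bigr => w _; congr (_ * _); apply: eq_bigr => x _.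
  by rewrite /mu mem_enum.
elim: s => [_ | x0 s IHs /= /andP[x0s us]].
  exact: lexx.
apply: (le_trans (IHs us)).
rewrite !(sum_prod_split x0 z0); apply: ler_sum => w _.
rewrite (eq_bigr (fun x => mu (x0 :: s) x (w x))); last first.
  by move=> x /negbTE xx0; rewrite /mu inE xx0.
apply: ler_wpM2l; first by apply: prodr_ge0.
by rewrite /mu inE eqxx (negbTE x0s).
Qed.

Definition subset_law (R : pzRingType) (X : finType) (p : R) (W : {set X}) : R :=
  \prod_x (if x \in W then p else 1 - p).

Lemma sum_set_ffun (R : nmodType) (X : finType) (F : {set X} -> R) :
  \sum_W F W = \sum_(w : {ffun X -> bool}) F [set x | w x].
Proof.
rewrite (reindex (fun w : {ffun X -> bool} => [set x | w x])) //=.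
exists (fun A : {set X} => [ffun x => x \in A]) => [w _ | A _].
  by apply/ffunP => x; rewrite ffunE inE.
by apply/setP => x; rewrite inE ffunE.
Qed.

Lemma sum_subset_law (R : comNzRingType) (X : finType) (p : R) :
  \sum_(W : {set X}) subset_law p W = 1.
Proof.
transitivity (\prod_(x : X) (p + (1 - p))); first by rewrite bigA_distr; apply: eq_bigl.
by rewrite big1 // => x _; rewrite addrC subrK.
Qed.

Lemma subset_law_ge0 (R : numDomainType) (X : finType) (p : R) (W : {set X}) :
  0 <= p <= 1 -> 0 <= subset_law p W.
Proof.
by case/andP=> p0 p1; apply: prodr_ge0 => x _; case: ifP => // _; rewrite subr_ge0.
Qed.

(** Sprinkling: a pair of independent random sets is a random function to [bool * bool], pushed
    forward along [||] to the law of the union. *)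
Lemma subset_law_setU (R : comNzRingType) (X : finType) (p1 p2 : R)
    (F : {set X} -> R) :
  \sum_W1 \sum_W2 subset_law p1 W1 * subset_law p2 W2 * F (W1 :|: W2) =
  \sum_W subset_law (p1 + p2 - p1 * p2) W * F W.
Proof.
pose nu (y : bool * bool) := (if y.1 then p1 else 1 - p1) * (if y.2 then p2 else 1 - p2).
rewrite [RHS]sum_set_ffun pair_big /=.
rewrite (reindex (fun w : {ffun X -> bool * bool} =>
    ([set x | (w x).1], [set x | (w x).2]))) /=; last first.
  exists (fun A : {set X} * {set X} => [ffun x => (x \in A.1, x \in A.2)]) => [w _ | [A B] _].
    by apply/ffunP => x; rewrite ffunE /= !inE; case: (w x).
  by congr pair; apply/setP => x; rewrite inE ffunE.
transitivity (\sum_(w : {ffun X -> bool * bool}) (\prod_x nu (w x)) *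
   F [set x | [ffun x => (w x).1 || (w x).2] x]).
  apply: eq_bigr => w _; rewrite /subset_law -big_split /=; congr (_ * F _).
    by apply: eq_bigr => x _; rewrite !inE.
  by apply/setP => x; rewrite !inE ffunE.
rewrite (sum_prod_comp (fun y => y.1 || y.2) nu (fun z => F [set x | z x])).
apply: eq_bigr => w _; congr (_ * _); apply: eq_bigr => x _.
rewrite inE (eq_bigr (fun y => nu (y.1, y.2))); last by case.
rewrite -(pair_big_dep predT (fun a b => (a || b) == w x) (fun a b => nu (a, b))) /=.
rewrite big_bool /= !big_mkcond !big_bool /= /nu /=.
by case: (w x) => /=; rewrite big_mkcond big_bool /=; ring.
Qed.

Lemma subset_law_mem (R : comNzRingType) (X : finType) (p : R) (x : X) :
  \sum_(W : {set X}) subset_law p W * (x \in W)%:R = p.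
Proof.
transitivity (\prod_y (p + (if y == x then 0 else 1 - p))).
  rewrite bigA_distr; apply: eq_bigr => W _.
  rewrite /subset_law; case: (boolP (x \in W)) => xW; rewrite ?mulr1 ?mulr0.
    apply: eq_bigr => y _; case: ifP => // yW; case: eqP => // yx.
    by rewrite yx xW in yW.
  by rewrite (bigD1 x) //= (negbTE xW) eqxx mul0r.
rewrite (bigD1 x) //= eqxx addr0 big1 ?mulr1 // => y /negbTE ->.
by rewrite addrC subrK.
Qed.

(** * Minimum fragments *)

Section Fragment.

Variables (X I : finType) (S : I -> {set X}) (J : {set I}).

(** The index [i], default of the minimum, is itself a candidate when [i \in J]. The minimizer may
    be a hyperedge other than [S i]. *)
Definition fragment (i : I) (W : {set X}) : {set X} :=
  S [arg min_(i' < i | (i' \in J) && (S i' \subset S i :|: W)) #|S i' :\: W|]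
    :\: W.

Variant fragment_spec i W : {set X} -> Prop :=
  FragmentSpec i' of i' \in J & S i' \subset S i :|: W
    & (forall i'', i'' \in J -> S i'' \subset S i :|: W ->
         (#|S i' :\: W| <= #|S i'' :\: W|)%N)
  : fragment_spec i W (S i' :\: W).

Lemma fragmentP i W : i \in J -> fragment_spec i W (fragment i W).
Proof.
move=> iJ; rewrite /fragment; case: arg_minnP => [|i' /andP[i'J sub] min].
  by rewrite iJ subsetUl.
by constructor=> // i'' i''J sub''; apply: min; rewrite i''J.
Qed.

Lemma fragment_sub i W : i \in J -> fragment i W \subset S i.
Proof. by move=> iJ; case: (fragmentP W iJ) => i' _ sub _; rewrite subDset setUC. Qed.

(** Such an [S i'] lies in [S i :|: W], so it competes in the minimum. Its part outside [W] lies in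
    the fragment, and minimality forces equality. *)
Lemma fragment_min i W i' : i \in J -> i' \in J ->
  S i' \subset W :|: fragment i W -> fragment i W \subset S i'.
Proof.
move=> iJ i'J sub.
have sub' : S i' :\: W \subset fragment i W by rewrite subDset.
have : S i' \subset S i :|: W.
  by apply: subset_trans sub _; rewrite setUC setSU ?fragment_sub.
case: (fragmentP W iJ) sub' => i0 _ _ min sub' /(min _ i'J) le.
suff -> : S i0 :\: W = S i' :\: W by apply: subsetDl.
by apply/eqP; rewrite eq_sym eqEcard sub'.
Qed.

End Fragment.

(** Each element of [T] trades a factor [1 - p <= 1] for [p], which [p^-1] makes up for. *)
Lemma subset_law_setU_le (R : realFieldType) (X : finType) (p : R)
    (W T : {set X}) : 0 < p <= 1 -> [disjoint T & W] ->
  subset_law p W <= subset_law p (W :|: T) * p^-1 ^+ #|T|.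
Proof.
case/andP=> p0 p1 dTW.
have q0 : 0 <= 1 - p by rewrite subr_ge0.
rewrite -prodr_const (big_mkcond (mem T)) -big_split /=.
apply: ler_prod => x _; rewrite !inE; case: ifP => [xW | nxW] /=.
  by rewrite (disjointFl dTW xW) mulr1 lexx ltW.
by case: ifP => xT; rewrite ?mulr1 ?lexx ?q0 //= mulfV ?gt_eqF // gerBl ltW.
Qed.

(** Double counting of [W] and a large fragment [T] through [Z = W :|: T]. Passing from [W] to [Z]
    costs [p^-1] per element of [T], spread bounds the indices sharing the fragment [T], and each
    [Z] leaves at most [2 ^ r] choices for [T]. *)
Lemma expected_large_fragments (R : realFieldType) (X I : finType)
    (S : I -> {set X}) (J : {set I}) (M x p kappa : R) (r s : nat) :
  0 < p <= 1 -> 0 < kappa -> (p * kappa)^-1 <= x -> x <= 1 -> 0 <= M ->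
  (forall i, i \in J -> #|S i| <= r)%N ->
  (forall U : {set X},
     #|[set i in J | U \subset S i]|%:R <= M * kappa^-1 ^+ #|U|) ->
  \sum_W subset_law p W *
    #|[set i in J | (s < #|fragment S J i W|)%N]|%:R <=
  M * 2 ^+ r * x ^+ s.+1.
Proof.
move=> p01 k0 xk x1 M0 Sr spread; have /andP[p0 p1] := p01.
have x0 : 0 <= x by apply: le_trans xk; rewrite invr_ge0 mulr_ge0 // ltW.
have law0 (W : {set X}) : 0 <= subset_law p W by rewrite subset_law_ge0 // ltW.
(* A hyperedge depending on [Z] alone; it contains every fragment [T] with [Z = W :|: T]. The
   default [set0] does not occur there, as the minimizer lies in [Z]. *)
pose S0 (Z : {set X}) := if [pick i in J | S i \subset Z] is Some i then S i else set0.
have S0_card Z : (#|S0 Z| <= r)%N.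
  rewrite /S0; case: pickP => [i /andP[iJ _] | _]; first exact: Sr.
  by rewrite cards0.
have frag0 i W : i \in J -> fragment S J i W \subset S0 (W :|: fragment S J i W).
  move=> iJ; rewrite /S0; case: pickP => [i' /andP[i'J sub] | none].
    exact: fragment_min.
  case: (fragmentP S W iJ) none => i0 i0J _ _ /(_ i0).
  by rewrite i0J -subDset subxx.
apply: (@le_trans _ _ (\sum_(W : {set X}) \sum_(T : {set X} | (s < #|T|)%N)
  if [disjoint T & W] && (T \subset S0 (W :|: T)) then
    subset_law p (W :|: T) * (M * x ^+ s.+1) else 0)).
  apply: ler_sum => W _.
  have -> : #|[set i in J | (s < #|fragment S J i W|)%N]|%:R =
    \sum_(T : {set X} | (s < #|T|)%N) #|[set i in J | fragment S J i W == T]|%:R :> R.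
    rewrite -natr_sum -sum1_card (partition_big (fun i => fragment S J i W)
      (fun T => s < #|T|)%N) /=; last by move=> i; rewrite inE => /andP[].
    congr _%:R; apply: eq_bigr => T sT; rewrite -sum1_card; apply: eq_bigl => i.
    by rewrite !inE; case: eqP => [->|]; rewrite ?sT ?andbT ?andbF.
  rewrite mulr_sumr; apply: ler_sum => T sT.
  have [none|[i]] := set_0Vmem [set i in J | fragment S J i W == T].
    by rewrite none cards0 mulr0; case: ifP => // _; rewrite !mulr_ge0 ?exprn_ge0.
  rewrite inE => /andP[iJ /eqP fT].
  have dT : [disjoint T & W].
    rewrite -fT; case: (fragmentP S W iJ) => i' _ _ _.
    by rewrite -setI_eq0 setIDAC setDIl setDv setI0.
  have TS0 : T \subset S0 (W :|: T) by rewrite -fT frag0.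
  rewrite dT TS0 /=.
  apply: (@le_trans _ _ (subset_law p (W :|: T) * p^-1 ^+ #|T| * (M * kappa^-1 ^+ #|T|))).
    apply: ler_pM => //; first exact: subset_law_setU_le.
    apply: le_trans (spread T); rewrite ler_nat subset_leq_card //.
    apply/subsetP => i'; rewrite !inE => /andP[i'J /eqP <-].
    by rewrite i'J fragment_sub.
  rewrite -mulrA ler_wpM2l // mulrCA ler_wpM2l // -exprMn -invfM.
  apply: le_trans (_ : x ^+ #|T| <= _).
    by rewrite lerXn2r // nnegrE // invr_ge0 mulr_ge0 // ltW.
  by rewrite ler_wiXn2l.
rewrite exchange_big /=.
apply: (@le_trans _ _ (\sum_(T : {set X} | (s < #|T|)%N) \sum_(Z : {set X})
  if T \subset S0 Z then subset_law p Z * (M * x ^+ s.+1) else 0)).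
  apply: ler_sum => T sT.
  rewrite -big_mkcond -[leRHS]big_mkcond /=.
  rewrite [leRHS](bigID (fun Z : {set X} => T \subset Z)) /=.
  rewrite ler_wpDr ?sumr_ge0 // => [Z _|]; first by rewrite !mulr_ge0 ?exprn_ge0.
  rewrite le_eqVlt; apply/orP; left; apply/eqP.
  (* For fixed [T], adding [T] is a bijection from the sets disjoint from [T] to the supersets of
     [T]. *)
  rewrite [RHS](reindex_onto (fun W : {set X} => W :|: T) (fun Z => Z :\: T)) /=; last first.
    by move=> Z /andP[_ TZ]; apply/setP=> y; rewrite !inE; have := subsetP TZ y; case: (y \in T); case: (y \in Z) => //= ->.
  apply: eq_bigl => W; rewrite subsetUr andbT andbC; congr (_ && _).
  rewrite setDUl setDv setU0 -setI_eq0 setIC; apply/eqP/eqP => /setP dis;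
    by apply/setP => y; move: (dis y); rewrite !inE; case: (y \in T); case: (y \in W).
rewrite exchange_big /=.
apply: (@le_trans _ _ (\sum_(Z : {set X}) subset_law p Z * (M * 2 ^+ r * x ^+ s.+1))).
  apply: ler_sum => Z _; rewrite -big_mkcondr /= sumr_const -[leLHS]mulr_natl.
   rewrite mulrCA ler_wpM2l // [M * _ * _]mulrAC -[leRHS]mulrC ler_wpM2r ?mulr_ge0 ?exprn_ge0 //.
  rewrite -natrX ler_nat; apply: leq_trans (_ : 2 ^ #|S0 Z| <= _)%N; last by rewrite leq_exp2l.
  rewrite -card_powerset subset_leq_card //; apply/subsetP => T.
  by rewrite !inE => /andP[].
by rewrite -mulr_suml sum_subset_law mul1r.
Qed.

(** * The spread lemma *)

Section SpreadLemma.

Variables (R : realFieldType) (X I : finType) (M kappa L : R) (m : nat).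
Hypotheses (M_ge0 : 0 <= M) (kappa_gt0 : 0 < kappa) (L_ge1 : 1 <= L).

Implicit Types (S : I -> {set X}) (J : {set I}) (W : {set X}).

Definition hits (S : I -> {set X}) (J : {set I}) (W : {set X}) : bool :=
  [exists i in J, S i \subset W].

Definition spread (S : I -> {set X}) (J : {set I}) : Prop :=
  forall U : {set X},
    #|[set i in J | U \subset S i]|%:R <= M * kappa^-1 ^+ #|U|.

(** The first term is the failure of the last round, on hyperedges of size at most [m]. The second
    bounds the losses [2^-1 ^+ r], [2^-1 ^+ r./2], and so on, of the halving rounds in a telescoping
    form. *)
Definition spread_loss (r : nat) : R :=
  2 ^+ m / L + (if (m < r)%N then 2^-1 ^+ m - 2^-1 ^+ r else 0).

Lemma subset_law_cst (Y : finType) (p c : R) :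
  c = \sum_(W : {set Y}) subset_law p W * c.
Proof. by rewrite -mulr_suml sum_subset_law mul1r. Qed.

Lemma spread_card S J : spread S J -> #|J|%:R <= M.
Proof.
move=> /(_ set0); rewrite cards0 expr0 mulr1; apply: le_trans.
by rewrite ler_nat subset_leq_card //; apply/subsetP => i iJ; rewrite inE iJ sub0set.
Qed.

Lemma spread_fragment S J W s : spread S J ->
  spread (fun i => fragment S J i W) [set i in J | (#|fragment S J i W| <= s)%N].
Proof.
move=> sp U; apply: le_trans (sp U); rewrite ler_nat subset_leq_card //.
apply/subsetP => i; rewrite !inE => /andP[/andP[iJ _] sub].
by rewrite iJ (subset_trans sub) ?fragment_sub.
Qed.

Lemma card_small_fragments S J W s :
  #|J|%:R = #|[set i in J | (#|fragment S J i W| <= s)%N]|%:R +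
            #|[set i in J | (s < #|fragment S J i W|)%N]|%:R :> R.
Proof.
rewrite -natrD -(cardsID [set i | (#|fragment S J i W| <= s)%N] J); congr (_ + _)%:R.
  by apply: eq_card => i; rewrite !inE.
by apply: eq_card => i; rewrite !inE -ltnNge andbC.
Qed.

(** The fragment of [i] is the rest of some hyperedge [S i'] outside [W]; covering this rest
    completes [S i'], not necessarily [S i]. *)
Lemma hits_fragment S J W W' s :
  hits (fun i => fragment S J i W) [set i in J | (#|fragment S J i W| <= s)%N] W' ->
  hits S J (W :|: W').
Proof.
move=> /existsP[i]; rewrite inE => /andP[/andP[iJ _]].
case: (fragmentP S W iJ) => i' i'J _ _ sub; apply/existsP; exists i'.
by rewrite i'J -subDset.
Qed.

(** When [W] contains no hyperedge, no fragment is empty, so all of [J] is counted among the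
    fragments larger than 0. *)
Lemma hits_last_round S J p r : spread S J ->
  (forall i, i \in J -> #|S i| <= r)%N -> p <= 1 -> L / kappa <= p ->
  #|J|%:R <= M * (\sum_W subset_law p W * (hits S J W)%:R + 2 ^+ r / L).
Proof.
move=> sp Sr p1 Lp.
have L0 : 0 < L by apply: lt_le_trans L_ge1.
have p0 : 0 < p by apply: lt_le_trans Lp; rewrite divr_gt0.
have p01 : 0 < p <= 1 by rewrite p0.
have xL : (p * kappa)^-1 <= L^-1.
  by rewrite lef_pV2 ?posrE ?mulr_gt0 // -ler_pdivrMr.
have L1 : L^-1 <= 1 by rewrite invf_le1.
have := expected_large_fragments 0 p01 kappa_gt0 xL L1 M_ge0 Sr sp.
rewrite expr1 => large; rewrite mulrDr mulrA.
apply: le_trans (lerD (lexx _) large); rewrite mulr_sumr -big_split /=.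
rewrite [leLHS](subset_law_cst X p); apply: ler_sum => W _.
rewrite mulrCA -mulrDr ler_wpM2l ?subset_law_ge0 ?(ltW p0) //.
rewrite (card_small_fragments S J W 0).
have [hit|nohit] := boolP (hits S J W).
  rewrite lerD2r mulr1; apply: le_trans (spread_card (spread_fragment W 0 sp)) _.
  exact: lexx.
rewrite mulr0 add0r gerDr.
have -> : #|[set i in J | (#|fragment S J i W| <= 0)%N]| = 0%N; last by [].
apply/eqP; rewrite cards_eq0; apply/eqP/setP => i; rewrite !inE.
apply/negP => /andP[iJ small]; case/negP: nohit.
rewrite -(setU0 W); apply: (@hits_fragment _ _ _ _ 0).
apply/existsP; exists i; rewrite inE iJ small /=.
by rewrite leqn0 cards_eq0 in small; rewrite (eqP small) sub0set.
Qed.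

Lemma spread_loss_half r : (m < r)%N -> spread_loss r./2 + 2^-1 ^+ r <= spread_loss r.
Proof.
move=> mr; rewrite /spread_loss mr -addrA lerD2l.
have half0 : 0 <= 2^-1 :> R by rewrite invr_ge0.
have half1 : 2^-1 <= 1 :> R by rewrite invf_le1 // ler1n.
have twice a : (a < r)%N -> 2^-1 ^+ r *+ 2 <= 2^-1 ^+ a :> R.
  move=> ar; rewrite -[r]prednK ?(leq_ltn_trans _ ar) // exprS -mulrnAl.
  rewrite -[2^-1 *+ 2]mulr_natl divff ?pnatr_eq0 // mul1r.
  by rewrite ler_wiXn2l // -ltnS prednK ?(leq_ltn_trans _ ar).
case: ifP => mr2.
  have := twice r./2; rewrite mulr2n => /(_ _)/wrap[]; last by lra.
  by rewrite -[ltnRHS]odd_double_half -addnn; case: (r./2) mr2 => // a _; lia.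
have := twice m mr; rewrite mulr2n; lra.
Qed.

(** Bounding [#|J|] against a fixed [M], instead of a probability, lets the induction pass to the
    subfamily of small fragments, which is spread with the same [M] and [kappa]. When
    [#|J| = M > 0], dividing by [M] bounds the hitting probability. *)
Theorem spread_lemma j S J p r : spread S J ->
  (forall i, i \in J -> #|S i| <= r)%N -> (r < 2 ^ j)%N ->
  p <= 1 -> (16 * j%:R + L) / kappa <= p ->
  #|J|%:R <= M * (\sum_W subset_law p W * (hits S J W)%:R + spread_loss r).
Proof.
elim: j S J p r => [|j IHj] S J p r sp Sr rj p1 jp.
  move: jp; rewrite mulr0 add0r => Lp.
  apply: le_trans (hits_last_round sp Sr p1 Lp) _.
  case: r rj {Sr} => // _; rewrite /spread_loss ltn0 addr0 ler_wpM2l // lerD2l.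
  by rewrite ler_wpM2r ?invr_ge0 ?(le_trans _ L_ge1) // ler_eXn2l // ltr1n.
have L0 : 0 < L by apply: lt_le_trans L_ge1.
have [rm|mr] := leqP r m.
  have Lp : L / kappa <= p.
    apply: le_trans jp; rewrite ler_wpM2r ?invr_ge0 ?(ltW kappa_gt0) //.
    by rewrite lerDr mulr_ge0.
  apply: le_trans (hits_last_round sp Sr p1 Lp) _.
  rewrite /spread_loss ltnNge rm addr0 ler_wpM2l // lerD2l.
  rewrite ler_wpM2r ?invr_ge0 ?(ltW L0) // ler_weXn2l // ler1n //.
(* Density [a] for this round and [b] for the later ones, so that the union of the two independent
   sets has density [a + b - a * b = p]. *)
pose a : R := 16 / kappa; pose b := (p - a) / (1 - a).
have a0 : 0 < a by rewrite divr_gt0.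
have jp' : (16 * j%:R + L) / kappa <= p - a.
  rewrite lerBrDr -mulrDl; apply: le_trans jp.
  by rewrite ler_wpM2r ?invr_ge0 ?(ltW kappa_gt0) // -[j.+1%:R]natr1 mulrDr mulr1 addrAC.
have pa : 0 < p - a.
  apply: lt_le_trans jp'; rewrite divr_gt0 // ltr_wpDl // mulr_ge0 //.
have a1 : a < 1 by apply: lt_le_trans p1; rewrite -subr_gt0.
have a1' : 0 < 1 - a by rewrite subr_gt0.
have b1 : b <= 1 by rewrite ler_pdivrMr // mul1r lerD2r.
have jb : (16 * j%:R + L) / kappa <= b.
  apply: le_trans jp' _; rewrite ler_pdivlMr // ler_piMr ?(ltW pa) //.
  by rewrite lerBlDr lerDl ltW.
have abp : a + b - a * b = p.
  rewrite /b; field; exact: lt0r_neq0.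
pose x : R := 16^-1.
have large : \sum_W subset_law a W *
    #|[set i in J | (r./2 < #|fragment S J i W|)%N]|%:R <= M * 2^-1 ^+ r.
  have a01 : 0 < a <= 1 by rewrite a0 ltW.
  have xa : (a * kappa)^-1 <= x by rewrite divfK ?gt_eqF.
  have x1 : x <= 1 by rewrite invf_le1 ?ler1n.
  apply: le_trans (expected_large_fragments r./2 a01 kappa_gt0 xa x1 M_ge0 Sr sp) _.
  rewrite -mulrA ler_wpM2l //.
  (* Since [2 * (r./2 + 1) >= r], the power of [16^-1] is at most [4^-1 ^+ r], which beats [2 ^+ r]
     by [2^-1 ^+ r]. *)
  have -> : x = 4^-1 ^+ 2 by rewrite /x; field.
  have -> : 2^-1 = 2 * 4^-1 :> R by field.
  rewrite [leRHS]exprMn ler_wpM2l ?exprn_ge0 // -exprM ler_wiXn2l ?invr_ge0 ?invf_le1 ?ler1n //.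
  by rewrite mulnS mul2n -[leqLHS]odd_double_half leq_add2r; case: (odd r).
(* Indices with a large fragment are given up; induction handles the others. *)
have step W1 : #|J|%:R <= M * (\sum_W subset_law b W * (hits S J (W1 :|: W))%:R + spread_loss r./2)
    + #|[set i in J | (r./2 < #|fragment S J i W1|)%N]|%:R.
  rewrite (card_small_fragments S J W1 r./2) lerD2r.
  have small i : i \in [set i in J | (#|fragment S J i W1| <= r./2)%N] ->
    (#|fragment S J i W1| <= r./2)%N by rewrite inE => /andP[].
  have r2 : (r./2 < 2 ^ j)%N.
    by rewrite ltn_half_double -mul2n -expnS.
  apply: le_trans (IHj _ _ _ _ (spread_fragment W1 _ sp) small r2 b1 jb) _.
  rewrite ler_wpM2l // lerD2r; apply: ler_sum => W _.
  rewrite ler_wpM2l ?subset_law_ge0 ?b1 ?(ltW (lt_le_trans _ jb)) ?divr_gt0 ?ltr_wpDl ?mulr_ge0 //.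
  by rewrite ler_nat; case: (boolP (hits _ _ W)) => // /hits_fragment ->.
have a01 : 0 <= a <= 1 by rewrite !ltW.
rewrite [leLHS](subset_law_cst X a).
apply: (@le_trans _ _ (\sum_(W1 : {set X}) subset_law a W1 *
   (M * (\sum_W subset_law b W * (hits S J (W1 :|: W))%:R + spread_loss r./2)
    + #|[set i in J | (r./2 < #|fragment S J i W1|)%N]|%:R))).
  by apply: ler_sum => W1 _; rewrite ler_wpM2l ?subset_law_ge0.
under eq_bigr do rewrite mulrDr mulrCA mulrDr mulr_sumr.
rewrite big_split /= -mulr_sumr big_split /= -mulr_suml sum_subset_law mul1r.
under eq_bigr do under eq_bigr do rewrite mulrA.
rewrite (subset_law_setU a b (fun W => (hits S J W)%:R)) abp.
apply: le_trans (lerD (lexx _) large) _; rewrite -mulrDr ler_wpM2l //.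
by rewrite -addrA lerD2l spread_loss_half.
Qed.

End SpreadLemma.

(** * Exclusive colors *)

Section ExclusiveColoring.

Variables (R : realFieldType) (X Q I : finType).
Variables (H : I -> {set X * Q}) (J : {set I}) (p : R).
Hypothesis H_functional : forall i x c c', i \in J ->
  (x, c) \in H i -> (x, c') \in H i -> c = c'.
Hypotheses (p01 : 0 <= p <= 1) (Q_gt0 : (0 < #|Q|)%N).

(** A set of pairs seen as one palette [z x] per block [x]. *)
Let hitsf (z : {ffun X -> {set Q}}) : bool :=
  [exists i in J, [forall u in H i, u.2 \in z u.1]].

(** One block under the exclusive law: presence with probability [p], and an independent uniform
    color drawn even for absent elements. *)
Let law_exclusive (y : bool * Q) : R := (if y.1 then p else 1 - p) * #|Q|%:R^-1.
Let palette (y : bool * Q) : {set Q} := if y.1 then [set y.2] else set0.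

Lemma sum_set_curry (F : {set X * Q} -> R) r :
  \sum_W subset_law r W * F W =
  \sum_(z : {ffun X -> {set Q}})
    (\prod_x subset_law r (z x)) * F [set u | u.2 \in z u.1].
Proof.
rewrite (reindex (fun z : {ffun X -> {set Q}} => [set u | u.2 \in z u.1])) /=; last first.
  exists (fun W : {set X * Q} => [ffun x => [set c | (x, c) \in W]]) => [z _ | W _].
    by apply/ffunP => x; rewrite ffunE; apply/setP => c; rewrite !inE.
  by apply/setP => -[x c]; rewrite !inE ffunE inE.
apply: eq_bigr => z _; congr (_ * _).
rewrite /subset_law pair_big /=; apply: eq_bigr => -[x c] _.
by rewrite inE.
Qed.

Lemma hitsf_upd_mono w x (z z' : {set Q}) : z \subset z' ->
  hitsf (upd w x z) -> hitsf (upd w x z').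
Proof.
move=> /subsetP zz' /existsP[i /andP[iJ /forallP hit]].
apply/existsP; exists i; rewrite iJ; apply/forallP => u; apply/implyP => uH.
have := implyP (hit u) uH; rewrite !ffunE; case: eqP => // _; exact: zz'.
Qed.

(** A hyperedge uses at most one color of the block [x]: either it ignores the block, or that single
    color suffices. *)
Lemma hitsf_upd_split w x (z : {set Q}) : hitsf (upd w x z) ->
  hitsf (upd w x set0) || [exists c in z, hitsf (upd w x [set c])].
Proof.
move=> /existsP[i /andP[iJ /forallP hit]].
have [/existsP[c xc]|nox] := boolP [exists c, (x, c) \in H i].
  apply/orP; right; apply/existsP; exists c.
  have := implyP (hit (x, c)) xc; rewrite ffunE /= eqxx => -> /=.
  apply/existsP; exists i; rewrite iJ; apply/forallP => -[y d]; apply/implyP => yd.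
  have := implyP (hit (y, d)) yd; rewrite !ffunE /=; case: eqP => // yx _.
  by rewrite inE; apply/eqP; apply: H_functional iJ _ xc; rewrite -yx.
apply/orP; left; apply/existsP; exists i; rewrite iJ.
apply/forallP => -[y d]; apply/implyP => yd.
have := implyP (hit (y, d)) yd; rewrite !ffunE /=; case: eqP => // yx _.
by case/existsP: nox; exists d; rewrite -yx.
Qed.

Lemma Q_neq0 : #|Q|%:R != 0 :> R.
Proof. by rewrite pnatr_eq0 -lt0n. Qed.

Lemma pQ01 : 0 <= p / #|Q|%:R <= 1.
Proof.
case/andP: p01 => p0 p1; rewrite divr_ge0 //= ler_pdivrMr ?ltr0n // mul1r.
by apply: le_trans p1 _; rewrite ler1n.
Qed.

(* McDiarmid's comparison in one block: away from the trivial case where the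
   block is irrelevant, only single colors [c] of the block can complete a
   hyperedge, and the union bound over [c] is attained by the exclusive law. *)
Lemma block_comparison w x :
  \sum_z subset_law (p / #|Q|%:R) z * (hitsf (upd w x z))%:R <=
  \sum_y law_exclusive y * (hitsf (upd w x (palette y)))%:R.
Proof.
have /andP[p0 p1] := p01; have /andP[pq0 pq1] := pQ01.
rewrite (eq_bigr (fun y => law_exclusive (y.1, y.2) *
  (hitsf (upd w x (palette (y.1, y.2))))%:R) (r := index_enum (bool * Q)%type)); last by case.
rewrite -[leRHS](pair_big predT predT (fun b c => law_exclusive (b, c) *
  (hitsf (upd w x (palette (b, c))))%:R)) /= big_bool /= /law_exclusive /palette /=.
have [hit0|nohit0] := boolP (hitsf (upd w x set0)).
  rewrite [X in _ <= X + _](eq_bigr (fun=> p * #|Q|%:R^-1)); last first.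
    by move=> c _; rewrite (hitsf_upd_mono (sub0set _) hit0) mulr1.
  rewrite !sumr_const -mulrnDl mulr1 -mulrDl addrC subrK mul1r.
  rewrite -[leRHS]mulr_natl divff ?Q_neq0 //.
  rewrite -[leRHS](sum_subset_law Q (p / #|Q|%:R)); apply: ler_sum => z _.
  by rewrite ler_piMr ?subset_law_ge0 ?pQ01 // lern1 leq_b1.
rewrite [X in _ + X]big1 ?addr0; last by move=> c _; rewrite mulr0.
apply: (@le_trans _ _ (\sum_(z : {set Q}) \sum_c subset_law (p / #|Q|%:R) z *
    (c \in z)%:R * (hitsf (upd w x [set c]))%:R)).
  apply: ler_sum => z _; rewrite -(eq_bigr _ (fun c _ => mulrA _ _ _)) -mulr_sumr.
  rewrite ler_wpM2l ?subset_law_ge0 ?pQ01 //.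
  case: (boolP (hitsf (upd w x z))) => [/hitsf_upd_split|_]; last first.
    by apply: sumr_ge0 => c _; rewrite mulr_ge0.
  rewrite (negbTE nohit0) /= => /existsP[c /andP[cz hitc]].
  by rewrite (bigD1 c) //= cz hitc mulr1 lerDl sumr_ge0 // => d _; rewrite mulr_ge0.
rewrite exchange_big /=; apply: ler_sum => c _.
by rewrite -mulr_suml subset_law_mem.
Qed.

(** The hybrid argument replaces the palettes block by block; the exclusive law is then read back as
    a random set with a random coloring. *)
Theorem independent_le_exclusive :
  \sum_W subset_law (p / #|Q|%:R) W * (hits H J W)%:R <=
  \sum_(w : {set X} * {ffun X -> Q}) subset_law p w.1 * (\prod_(x : X) #|Q|%:R^-1) *
    [exists i in J, [forall u in H i, (u.1 \in w.1) && (w.2 u.1 == u.2)]]%:R.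
Proof.
have /andP[p0 p1] := p01.
have excl0 y : 0 <= law_exclusive y.
  by rewrite mulr_ge0 ?invr_ge0 //; case: ifP; rewrite ?subr_ge0.
pose nu2 z : R := \sum_(y | palette y == z) law_exclusive y.
have -> : \sum_W subset_law (p / #|Q|%:R) W * (hits H J W)%:R =
    \sum_(z : {ffun X -> {set Q}}) (\prod_x subset_law (p / #|Q|%:R) (z x)) * (hitsf z)%:R.
  rewrite sum_set_curry; apply: eq_bigr => z _; congr (_ * (nat_of_bool _)%:R).
  rewrite /hits /hitsf; apply: eq_existsb_in => i _; apply/subsetP/forallP => sub u.
    by apply/implyP => /sub; rewrite inE.
  by move=> uH; rewrite inE (implyP (sub u)).
apply: le_trans (ler_sum_prod (nu2 := nu2) set0 _ _ _) _.
- by move=> z; rewrite subset_law_ge0 // pQ01.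
- by move=> z; rewrite sumr_ge0.
- move=> x w; apply: le_trans (block_comparison w x) _.
  rewrite (partition_big palette predT) //= le_eqVlt; apply/orP; left; apply/eqP.
  apply: eq_bigr => z _; rewrite /nu2 mulr_suml.
  by apply: eq_bigr => y /eqP <-.
rewrite /nu2 -(sum_prod_comp palette law_exclusive (fun z => (hitsf z)%:R)).
rewrite (reindex (fun w : {set X} * {ffun X -> Q} => [ffun x => (x \in w.1, w.2 x)])) /=; last first.
  exists (fun v : {ffun X -> bool * Q} => ([set x | (v x).1], [ffun x => (v x).2])).
    move=> [E f] _ /=; congr pair; first by apply/setP => x; rewrite inE ffunE.
    by apply/ffunP => x; rewrite !ffunE.
  by move=> v _; apply/ffunP => x; rewrite !ffunE inE; case: (v x).
rewrite le_eqVlt; apply/orP; left; apply/eqP; apply: eq_bigr => -[E f] _ /=.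
rewrite /subset_law -big_split /=; congr (_ * (nat_of_bool _)%:R).
  by apply: eq_bigr => x _; rewrite ffunE.
rewrite /hitsf; apply: eq_existsb_in => i _; apply: eq_forallb_in => u _.
by rewrite !ffunE /palette /=; case: (u.1 \in E); rewrite inE //= eq_sym.
Qed.

End ExclusiveColoring.

(** * Colored injections *)

Section ColoredInjections.

Variables (A B K : finType) (colA : A -> K) (colB : B -> K).

Definition colored_inj : {set {ffun A -> B}} :=
  [set r : {ffun A -> B} | injectiveb r && [forall a, colB (r a) == colA a]].

Lemma colored_injP (r : {ffun A -> B}) :
  reflect (injective r /\ forall a, colB (r a) = colA a) (r \in colored_inj).
Proof.
rewrite inE; apply: (iffP andP) => [[/injectiveP ir /forallP cr]|[ir cr]].
  by split=> // a; apply/eqP.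
by split; [apply/injectiveP | apply/forallP => a; apply/eqP].
Qed.

Definition class_size (j : K) : nat := #|[set b | colB b == j]|.

Definition prescribed (l : seq A) (g : A -> B) : {set {ffun A -> B}} :=
  [set r in colored_inj | all (fun a => r a == g a) l].

(* Composing with the transposition of [g a] and a free value [b] of the right
   color gives as many functions for each [b]. *)
Lemma prescribed_cons a l g : uniq (a :: l) ->
  (#|prescribed (a :: l) g| *
     (class_size (colA a) - count (fun a' => colA a' == colA a) l) <=
   #|prescribed l g|)%N.
Proof.
move=> /= /andP[al ul].
have [->|[r0]] := set_0Vmem (prescribed (a :: l) g); first by rewrite cards0 mul0n.
rewrite inE => /andP[/colored_injP[ir0 cr0] /= /andP[/eqP r0a /allP r0l]].
pose free := [set b | colB b == colA a] :\: [set b in map g l].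
have free_ge : (class_size (colA a) - count (fun a' => colA a' == colA a) l <= #|free|)%N.
  rewrite /free cardsD leq_sub2l //.
  apply: leq_trans (_ : size (map g [seq a' <- l | colA a' == colA a]) <= _)%N; last first.
    by rewrite size_map size_filter.
  apply: leq_trans (card_size _); rewrite subset_leq_card //; apply/subsetP => b.
  rewrite !inE => /andP[/eqP cb /mapP[a' a'l ba']]; apply/mapP; exists a' => //.
  by rewrite mem_filter a'l andbT -cr0 (eqP (r0l a' a'l)) -ba' cb.
apply: leq_trans (leq_mul (leqnn _) free_ge) _.
rewrite -cardsX.
pose swap (u : {ffun A -> B} * B) : {ffun A -> B} :=
  [ffun x => tperm (g a) u.2 (u.1 x)].
have swap_a r b : r \in prescribed (a :: l) g -> swap (r, b) a = b.
  by rewrite !inE => /andP[_ /= /andP[/eqP ra _]]; rewrite ffunE /= ra tpermL.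
(* The swapped function reveals [b] as its value at [a], and then [r] by undoing the
   transposition. *)
rewrite -(card_in_imset (f := swap)); last first.
  move=> [r b] [r' b']; rewrite !in_setX => /andP[rP _] /andP[r'P _] eq.
  have bb' : b = b' by rewrite -(swap_a r b rP) -(swap_a r' b' r'P) eq.
  congr pair => //; apply/ffunP => x; move/ffunP: eq => /(_ x).
  by rewrite !ffunE /= bb' => /perm_inj.
apply: subset_leq_card; apply/subsetP => s /imsetP[[r b]]; rewrite in_setX => /andP[].
rewrite [in X in X -> _]inE => /andP[/colored_injP[ir cr] /= /andP[/eqP ra /allP rl]].
rewrite in_setD !inE => /andP[bl /eqP cb] ->.
apply/andP; split.
  have := colored_injP (swap (r, b)); rewrite inE => /introT; apply; split.
    by move=> x y; rewrite !ffunE => /perm_inj/ir.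
  move=> x; rewrite ffunE /=; case: tpermP => [E|E|_ _]; last exact: cr.
    by rewrite -(cr x) E cb -r0a cr0.
  by rewrite -r0a cr0 -(cr x) E cb.
apply/allP => x xl; rewrite ffunE /= tpermD ?(eqP (rl x xl)) //.
  rewrite -ra -(eqP (rl x xl)); apply: contraNneq al => /ir ->; exact: xl.
by apply: contraNneq bl => ->; apply: map_f.
Qed.

(** Each fixed value uses up one element of its color class, hence one falling factorial per
    color. *)
Lemma card_prescribed_ffact l g : uniq l ->
  (#|prescribed l g| *
     \prod_j class_size j ^_ (count (fun a => colA a == j) l) <= #|colored_inj|)%N.
Proof.
elim: l => [_ | a l IHl ul].
  rewrite big1 // muln1 subset_leq_card //; apply/subsetP => r.
  by rewrite inE => /andP[].
have /= /andP[_ ul'] := ul; apply: leq_trans (IHl ul').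
rewrite (bigD1 (colA a)) //= [in leqRHS](bigD1 (colA a)) //= eqxx add1n ffactnSr.
rewrite (eq_bigr (fun j => class_size j ^_ (count (fun a => colA a == j) l))); last first.
  by move=> j /negbTE; rewrite eq_sym => ->.
rewrite !mulnA leq_mul2r; apply/orP; right.
by rewrite mulnAC leq_mul2r prescribed_cons ?orbT.
Qed.

Lemma count_le_class_size l r : uniq l -> r \in colored_inj ->
  forall j, (count (fun a => colA a == j) l <= class_size j)%N.
Proof.
move=> ul /colored_injP[ir cr] j.
rewrite -size_filter -(size_map r).
have /card_uniqP <- : uniq (map r [seq a <- l | colA a == j]).
  by rewrite map_inj_uniq // filter_uniq.
apply: subset_leq_card; apply/subsetP => b /mapP[a].
by rewrite mem_filter inE => /andP[/eqP <- _] ->; rewrite cr.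
Qed.

End ColoredInjections.

(** The induction step is [(n + 1)^a <= e * n^a] for [a <= n], from [(1 + 1/n)^n <= e]. *)
Lemma expn_le_ffact (R : realType) (n a : nat) : (a <= n)%N ->
  n%:R ^+ a <= expR 1 ^+ a * (n ^_ a)%:R :> R.
Proof.
elim: n a => [|n IHn] [|a] //=; rewrite ?expr0 ?ffactn0 ?mul1r //.
rewrite ltnS => an; rewrite ffactnS exprS [expR 1 ^+ _]exprS natrM /=.
rewrite mulrCA ler_wpM2l // -mulrA.
apply: le_trans (_ : expR 1 * n%:R ^+ a <= _); last first.
  by rewrite ler_wpM2l ?expR_ge0 ?IHn.
case: n an {IHn} => [|n] an.
  by move: an; rewrite leqn0 => /eqP ->; rewrite !expr0 mulr1 ltW // expR_gt1.
have n0 : 0 < n.+1%:R :> R by rewrite ltr0n.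
have -> : n.+2%:R = n.+1%:R * (1 + n.+1%:R^-1) :> R.
  by rewrite mulrDr mulr1 divff ?gt_eqF // natr1.
rewrite exprMn mulrC ler_wpM2r ?exprn_ge0 //.
apply: le_trans (_ : expR (n.+1%:R^-1) ^+ n.+1 <= _); last first.
  by rewrite -expRM_natl mulfV ?gt_eqF.
apply: le_trans (_ : (1 + n.+1%:R^-1) ^+ n.+1 <= _).
  by rewrite ler_weXn2l // lerDl invr_ge0.
by rewrite lerXn2r ?nnegrE ?expR_ge0 ?expR_ge1Dx // addr_ge0 // invr_ge0.
Qed.

Lemma prod_seq_color (R : comNzRingType) (A K : finType) (col : A -> K)
    (F : K -> R) (l : seq A) :
  \prod_(a <- l) F (col a) = \prod_j F j ^+ count (fun a => col a == j) l.
Proof.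
rewrite (partition_big col predT) //=; apply: eq_bigr => j _.
rewrite (eq_bigr (fun=> F j)) => [|a /eqP -> //].
by rewrite big_const_seq iter_mulr_1.
Qed.

(** Trading falling factorials for powers makes the gain per prescribed value independent of what
    was fixed before. A prescribed function, if any, shows that no color occurs in [l] more often
    than its class allows. *)
Lemma card_prescribed (R : realType) (A B K : finType) (colA : A -> K)
    (colB : B -> K) (l : seq A) (g : A -> B) : uniq l ->
  #|prescribed colA colB l g|%:R *
    \prod_(a <- l) ((class_size colB (colA a))%:R / expR 1) <=
  #|colored_inj colA colB|%:R :> R.
Proof.
move=> ul; have [->|[r]] := set_0Vmem (prescribed colA colB l g).
  by rewrite cards0 mul0r.
rewrite inE => /andP[rV _].
apply: le_trans (_ : (#|prescribed colA colB l g| *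
   \prod_j class_size colB j ^_ (count (fun a => colA a == j) l))%:R <= _); last first.
  by rewrite ler_nat card_prescribed_ffact.
rewrite natrM ler_wpM2l // natr_prod.
rewrite (prod_seq_color _ (fun j => (class_size colB j)%:R / expR 1)).
apply: ler_prod => j _; rewrite exprn_ge0 ?divr_ge0 ?expR_ge0 //=.
rewrite exprMn exprVn ler_pdivrMr ?exprn_gt0 ?expR_gt0 // mulrC.
by rewrite expn_le_ffact // (count_le_class_size ul rV).
Qed.

(** * Adjacencies along a cycle *)

Section ChainCounting.

Variables (R : realType) (A B K : finType) (colA : A -> K) (colB : B -> K).
Variables (f : A -> A) (nb : B -> {set B}) (delta : R).
Hypotheses (f_inj : injective f) (nb_le2 : forall b, (#|nb b| <= 2)%N).
Hypotheses (class_gt0 : forall a, (0 < class_size colB (colA a))%N).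
Hypothesis delta_ge0 : 0 <= delta.
Hypothesis delta_le :
  forall a, delta <= (class_size colB (colA a))%:R / expR 1 / 2.

Let rate (a : A) : R := (class_size colB (colA a))%:R / expR 1.
Let V := colored_inj colA colB.

(** State of the exposure: the values on [l] are fixed by [g], and the adjacencies of the [t] steps
    from [x] on are still to be used. *)
Definition chained (P : {set A}) x l t g : {set {ffun A -> B}} :=
  [set r in prescribed colA colB l g |
    all (fun y => (y \in P) ==> (r (f y) \in nb (r y))) (traject f x t)].

Implicit Types (P : {set A}) (g : A -> B).

(** Gain over number of choices when [f y] is exposed: half of [rate (f y)], so at least [delta],
    for 2 choices; [1 / e] for a whole color class; 1 when [f y] is not exposed. *)
Definition step_weight (P : {set A}) (y : A) : R :=
  if y \in P then delta else if f y \in P then (expR 1)^-1 else 1.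

Lemma step_weight_ge0 P y : 0 <= step_weight P y.
Proof. by rewrite /step_weight; case: ifP => // _; case: ifP => // _; rewrite invr_ge0 expR_ge0. Qed.

Lemma chained_split P x l t g (D : {set B}) : f x \notin l ->
  (forall r, r \in chained P x l t.+1 g -> r (f x) \in D) ->
  (#|chained P x l t.+1 g| <=
   \sum_(b in D) #|chained P (f x) (f x :: l) t (fun a => if a == f x then b else g a)|)%N.
Proof.
move=> fxl inD.
rewrite -sum1_card (partition_big (fun r : {ffun A -> B} => r (f x)) (mem D)) //=.
apply: leq_sum => b _; rewrite sum1_card; apply: subset_leq_card.
apply/subsetP => r; rewrite unfold_in => /andP[]; rewrite !inE /= => /andP[/andP[-> rl] /andP[_ ->]] rfx.
rewrite eqxx rfx andbT /=; apply/allP => a al; have [afx|_] := eqVneq a (f x); first by rewrite afx (negbTE fxl) in al.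
exact: (allP rl).
Qed.

(* Exposing the image of [f x] costs 2 choices when [x \in P] and a whole color
   class otherwise, against a gain of [rate (f x)]; vertices away from [P] are
   skipped. *)
Lemma card_chained_steps P t x l g : uniq (l ++ traject f (f x) t) ->
  (x \in P -> x \in l) ->
  #|chained P x l t g|%:R * \prod_(y <- traject f x t) step_weight P y *
    \prod_(a <- l) rate a <= #|V|%:R.
Proof.
elim: t x l g => [|t IHt] x l g ul xPl.
  rewrite big_nil mulr1 cats0 in ul *; apply: le_trans (card_prescribed R colA colB g ul).
  rewrite ler_wpM2r ?prodr_ge0 // => [a _|]; first by rewrite divr_ge0 ?expR_ge0.
  by rewrite ler_nat subset_leq_card //; apply/subsetP => r; rewrite inE => /andP[].
have fxl : f x \notin l.
  by move: ul; rewrite cat_uniq => /and3P[_ /hasPn/(_ (f x))]; rewrite mem_head => ->.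
have ufx : uniq ((f x :: l) ++ traject f (f (f x)) t).
  by rewrite cat_cons -cat1s uniq_catCA.
have fxPl : f x \in P -> f x \in f x :: l by rewrite mem_head.
pose W : R := \prod_(y <- traject f (f x) t) step_weight P y.
pose T : R := \prod_(a <- l) rate a.
have W0 : 0 <= W by apply: prodr_ge0 => y _; apply: step_weight_ge0.
have T0 : 0 <= T by apply: prodr_ge0 => a _; rewrite divr_ge0 ?expR_ge0.
have WTr0 : 0 <= W * T * rate (f x).
  by rewrite !mulr_ge0 ?invr_ge0 ?expR_ge0.
(* Sums the induction hypothesis over the possible images of [f x]; the factor [rate (f x)] comes
   from enlarging [l]. *)
have bound (D : {set B}) :
    (forall r, r \in chained P x l t.+1 g -> r (f x) \in D) ->
    #|chained P x l t.+1 g|%:R * (W * T * rate (f x)) <= #|D|%:R * #|V|%:R.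
  move=> inD; apply: le_trans (_ : (\sum_(b in D) #|V|%:R) <= _); last first.
    by rewrite sumr_const mulr_natl.
  have := chained_split fxl inD; rewrite -(ler_nat R) natr_sum.
  move=> /(ler_wpM2r WTr0).
  move=> /le_trans; apply; rewrite mulr_suml; apply: ler_sum => b _.
  have := IHt (f x) (f x :: l) (fun a => if a == f x then b else g a) ufx fxPl.
  by rewrite big_cons -/W -/T [rate _ * T]mulrC !mulrA.
rewrite big_cons -/W -/T /step_weight.
case: ifP => [xP | xP].
  have := bound (nb (g x)) => /(_ _)/wrap[].
    move=> r; rewrite !inE /= xP => /andP[/andP[_ rl] /andP[/= rfx _]].
    by rewrite -(eqP (allP rl x (xPl xP))).
  move=> bnd.
  have {bnd} : #|chained P x l t.+1 g|%:R * (W * T * rate (f x)) <= 2 * #|V|%:R.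
    by apply: le_trans bnd _; rewrite ler_wpM2r // ler_nat.
  have := ler_wpM2l (mulr_ge0 (ler0n R #|chained P x l t.+1 g|) (mulr_ge0 W0 T0)) (delta_le (f x)).
  rewrite -/(rate (f x)).
  set c := #|_|%:R; set v := #|V|%:R.
  have -> : c * (W * T) * delta = c * (delta * W) * T by ring.
  have -> : c * (W * T) * (rate (f x) / 2) = c * (W * T * rate (f x)) / 2 by ring.
  lra.
case: ifP => [fxP | fxP].
  have := bound [set b | colB b == colA (f x)] => /(_ _)/wrap[].
    by move=> r; rewrite !inE => /andP[/andP[/andP[_ /forallP/(_ (f x))]]].
  rewrite -/(class_size colB (colA (f x))) /rate.
  have n0 : 0 < (class_size colB (colA (f x)))%:R :> R by rewrite ltr0n.
  set c := #|_|%:R; set v := #|V|%:R; set n := (class_size _ _)%:R in n0 *.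
  have -> : c * (W * T * (n / expR 1)) = n * (c * ((expR 1)^-1 * W) * T) by ring.
  by rewrite ler_pM2l.
rewrite mul1r; apply: le_trans (IHt (f x) l g _ _); last 2 first.
- by move: ufx; rewrite /= => /andP[].
- by rewrite fxP.
rewrite -!mulrA ler_wpM2r ?mulr_ge0 // ler_nat; apply: subset_leq_card.
by apply/subsetP => r; rewrite !inE /= => /andP[-> /andP[_ ->]].
Qed.

Definition cyclic_adjacent (P : {set A}) : {set {ffun A -> B}} :=
  [set r in V | [forall y in P, r (f y) \in nb (r y)]].

Hypothesis f_cycle : forall x, uniq (traject f x #|A|).

Lemma mem_cycle x y : y \in traject f x #|A|.
Proof.
have /uniq_min_size := f_cycle x; move=> /(_ (enum A)) [].
- by move=> z _; rewrite mem_enum.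
- by rewrite size_traject cardE.
by move=> _ ->; rewrite mem_enum.
Qed.

Lemma perm_traject x : perm_eq (traject f x #|A|) (index_enum A).
Proof.
apply: uniq_perm => [||y]; rewrite ?f_cycle ?index_enum_uniq //.
by rewrite mem_cycle mem_index_enum.
Qed.

(** From a start outside [P] nothing has to be fixed beforehand. A full turn meets [#|P|] vertices
    of [P], each with weight [delta], and, [f] being injective, [#|P|] predecessors of vertices of
    [P], each losing at most a factor [e]. *)
Lemma card_cyclic_adjacent_proper P x : x \notin P ->
  #|cyclic_adjacent P|%:R * (delta / expR 1) ^+ #|P| <= #|V|%:R.
Proof.
move=> xP; have [->|[g gP]] := set_0Vmem (cyclic_adjacent P).
  by rewrite cards0 mul0r.
have ux : uniq ([::] ++ traject f (f x) #|A|) by exact: f_cycle.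
have xn : x \in P -> x \in [::] by rewrite (negbTE xP).
have := card_chained_steps g ux xn; rewrite big_nil mulr1; apply: le_trans.
apply: ler_pM; rewrite ?exprn_ge0 ?divr_ge0 ?expR_ge0 //.
  rewrite ler_nat subset_leq_card //; apply/subsetP => r; rewrite !inE andbT.
  by move=> /andP[-> /forallP rP] /=; apply/allP => y _; apply: rP.
have e0 : 0 <= (expR 1)^-1 :> R by rewrite invr_ge0 expR_ge0.
have e1 : (expR 1)^-1 <= 1 :> R by rewrite invf_le1 ?expR_gt0 // ltW // expR_gt1.
have de : delta / expR 1 <= delta by rewrite ler_piMr.
rewrite (perm_big _ (perm_traject x)) /= exprMn.
have -> : (expR 1)^-1 ^+ #|P| = \prod_y (if f y \in P then (expR 1)^-1 else 1) :> R.
  rewrite -prodr_const big_mkcond /= (reindex_inj f_inj) /=.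
  by apply: eq_bigr => y _.
rewrite -prodr_const (big_mkcond (mem P)) -big_split /=.
apply: ler_prod => y _; rewrite /step_weight; case: (y \in P); case: (f y \in P);
  by rewrite ?mulr1 ?mul1r ?mulr_ge0 ?delta_ge0 ?e0 ?ler01 ?de ?lexx.
Qed.

(* If [P] is everything the exposure closes up, so one vertex is dropped from
   [P]; the lost factor is at most [2 ^ #|A|], hence the extra division by 2. *)
Lemma card_cyclic_adjacent P : delta / expR 1 <= 2 ^+ #|A| -> (0 < #|A|)%N ->
  #|cyclic_adjacent P|%:R * (delta / expR 1 / 2) ^+ #|P| <= #|V|%:R.
Proof.
move=> small A0; have e0 : 0 <= delta / expR 1 by rewrite divr_ge0 ?expR_ge0.
have half : delta / expR 1 / 2 <= delta / expR 1.
  by rewrite ler_pdivrMr // ler_peMr // ler1n.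
have [PT|[x xP]] := set_0Vmem (~: P); last first.
  rewrite inE in xP; apply: le_trans (card_cyclic_adjacent_proper xP).
  by rewrite ler_wpM2l // lerXn2r // nnegrE // divr_ge0.
have {}PT : P = setT by rewrite -[P]setCK PT setC0.
have /card_gt0P[x _] := A0.
have xP : x \notin P :\ x by rewrite !inE eqxx.
apply: le_trans (card_cyclic_adjacent_proper xP).
apply: ler_pM; rewrite ?exprn_ge0 ?divr_ge0 ?expR_ge0 //.
  rewrite ler_nat subset_leq_card //; apply/subsetP => r; rewrite !inE.
  move=> /andP[-> /forallP rP] /=; apply/forallP => y; rewrite !inE.
  by apply/implyP => /andP[_ yP]; apply: (implyP (rP y)).
have -> : #|P| = #|P :\ x|.+1 by rewrite (cardsD1 x P) PT inE.
rewrite exprMn exprS -mulrA mulrCA ler_piMr ?exprn_ge0 //.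
rewrite exprVn ler_pdivrMr ?exprn_gt0 // mul1r; apply: le_trans small _.
have -> : #|P :\ x|.+1 = #|A|; last exact: lexx.
by rewrite -cardsT -PT (cardsD1 x P) PT inE.
Qed.

End ChainCounting.

(** * Rainbow Hamilton cycles as hyperedges *)

Lemma val_iter_ordS n i (j : 'I_n) : iter i (@ordS n) j = ((j + i) %% n)%N :> nat.
Proof.
elim: i => [|i IHi] /=; first by rewrite addn0 modn_small.
by rewrite IHi -addn1 modnDml addn1 addnS.
Qed.

Lemma ordS_neq n (j : 'I_n) : (1 < n)%N -> ordS j != j.
Proof.
move=> n1; apply/eqP => /(congr1 val) /=; have jn := ltn_ord j.
have [jn1|] := ltnP j.+1 n; first by rewrite modn_small //; lia.
move=> nj; have -> : j.+1 = n by lia.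
by rewrite modnn; lia.
Qed.

(** Otherwise [i = j + 1] and [j = i + 1], so 2 would vanish modulo [n], which happens for
    [n = 2]. *)
Lemma ordS_pair_inj n (i j : 'I_n) : (2 < n)%N ->
  [set i; ordS i] = [set j; ordS j] -> i = j.
Proof.
move=> n2 /setP eq.
have := eq i; rewrite !inE eqxx /= => /esym/orP[/eqP // | /eqP ij].
have := eq j; rewrite !inE eqxx /= => /orP[/eqP // | /eqP ji].
have := congr1 val ji; rewrite ij /= -[(j.+1 %% n).+1]addn1 modnDml addn1.
have jn := ltn_ord j; have [jn2|] := ltnP j.+2 n; first by rewrite modn_small //; lia.
rewrite leq_eqVlt => /orP[/eqP nj|nj]; first by rewrite -nj modnn; lia.
have -> : j.+2 = (1 + n)%N by lia.
by rewrite modnDr modn_small //; lia.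
Qed.

Lemma next_enum_ord n (j : 'I_n) : next (enum 'I_n) j = ordS j.
Proof.
apply: val_inj; rewrite -(next_map val_inj) ?enum_uniq // val_enum_ord.
case: n j => [[]//|n] j; rewrite next_nth mem_iota /= add0n ltn_ord.
rewrite [X in nth _ _ X](_ : _ = j :> nat); last first.
  transitivity (index (nth 0%N (iota 0 n.+1) j) (iota 0 n.+1)).
    by rewrite nth_iota ?ltn_ord.
  by rewrite index_uniq ?size_iota ?iota_uniq ?ltn_ord.
have [jn|nj] := ltnP j n; first by rewrite nth_iota // add1n modn_small.
rewrite nth_default ?size_iota //.
have -> : j = n :> nat by have := ltn_ord j; lia.
by rewrite modnn.
Qed.

Section HamiltonHypergraph.

Variables (R : realType) (n k q : nat) (c : 'I_n -> 'I_k) (cs : n.-tuple 'I_k).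
Hypothesis n_gt2 : (2 < n)%N.

Definition placements : {set {ffun 'I_n -> 'I_n}} := colored_inj c (tnth cs).

(** The constant color maps leave injectivity as the only constraint, so the counting of colored
    injections applies here as well. *)
Definition palettes : {set {ffun 'I_n -> 'I_q}} :=
  colored_inj (fun _ : 'I_n => tt) (fun _ : 'I_q => tt).

Definition template := ({ffun 'I_n -> 'I_n} * {ffun 'I_n -> 'I_q})%type.

(* [t.1] sends a vertex to its position on the cycle and [t.2] sends a position
   [j] to the color of the edge joining the positions [j] and [j + 1]. *)
Definition colored_cycle (t : template) : {set edge n * 'I_q} :=
  [set u : edge n * 'I_q | [exists j, (t.1 @: val u.1 == [set j; ordS j]) && (t.2 j == u.2)]].

Definition templates : {set template} := setX placements palettes.

Implicit Types (t : template) (u : edge n * 'I_q).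

Lemma colored_cycleP t u : reflect
  (exists2 j, t.1 @: val u.1 = [set j; ordS j] & t.2 j = u.2) (u \in colored_cycle t).
Proof.
rewrite inE; apply: (iffP existsP) => [[j /andP[/eqP tj /eqP uj]] | [j tj uj]].
  by exists j.
by exists j; rewrite tj uj !eqxx.
Qed.

Lemma templatesP t : reflect
  [/\ injective t.1, forall v, tnth cs (t.1 v) = c v & injective t.2]
  (t \in templates).
Proof.
case: t => r g; rewrite in_setX; apply: (iffP andP) => /=.
  by case=> /colored_injP[ir cr] /colored_injP[ig _].
by case=> ir cr ig; split; apply/colored_injP.
Qed.

Lemma colored_cycle_functional t e i i' : t \in templates ->
  (e, i) \in colored_cycle t -> (e, i') \in colored_cycle t -> i = i'.
Proof.
move=> _ /colored_cycleP[j ej /= <-] /colored_cycleP[j' ej' /= <-].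
by congr (t.2 _); apply: ordS_pair_inj; rewrite // -ej -ej'.
Qed.

(** The color determines the position through [t.2], and the position determines the edge through
    [t.1]. *)
Lemma colored_cycle_color_inj t : t \in templates ->
  {in colored_cycle t &, injective snd}.
Proof.
move=> /templatesP[ir _ ig] [e i] [e' i'] /colored_cycleP[j ej /= <-].
move=> /colored_cycleP[j' ej' /= <-] /ig jj'; rewrite -jj' in ej' *.
by congr pair; apply/val_inj/(imset_inj ir); rewrite ej ej'.
Qed.

Lemma card_colored_cycle t : t \in templates -> (#|colored_cycle t| <= n)%N.
Proof.
move=> tT; rewrite -(card_in_imset (colored_cycle_color_inj tT)).
apply: leq_trans (_ : #|t.2 @: [set: 'I_n]| <= _)%N; last first.
  by apply: leq_trans (leq_imset_card _ _) _; rewrite cardsT card_ord.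
apply: subset_leq_card; apply/subsetP => i /imsetP[u /colored_cycleP[j _ <-] ->].
exact: imset_f.
Qed.

(** The inverse [s] of the placement lists the vertices along the cycle; injectivity of [t.2] makes
    it rainbow. *)
Lemma colored_cycle_hits t (w : outcome n q) : t \in templates ->
  (forall u, u \in colored_cycle t -> (u.1 \in w.1) && (w.2 u.1 == u.2)) ->
  has_colored_rainbow_hamilton c cs w.
Proof.
move=> /templatesP[ir cr ig] hit; pose s := invF ir.
have is_ : injective s by move=> i j /(congr1 t.1); rewrite !f_invF.
pose x := [tuple s j | j < n].
have x_map : x = map s (enum 'I_n) :> seq _ by [].
have x_uniq : uniq x by rewrite x_map map_inj_uniq ?enum_uniq.
have next_s j : next x (s j) = s (ordS j).
  by rewrite x_map next_map ?enum_uniq ?next_enum_ord.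
have edge_s (e : edge n) j : val e = [set s j; s (ordS j)] -> (e, t.2 j) \in colored_cycle t.
  move=> ej; apply/colored_cycleP; exists j => //=.
  by rewrite ej imsetU1 imset_set1 !f_invF.
apply/existsP; exists x; apply/and3P; split.
- rewrite /hamilton_cycle n_gt2 /= /ucycleb x_uniq andbT.
  apply: cycle_from_next => // v _; rewrite -(invF_f ir v) -/s next_s.
  have e2 : #|[set s (t.1 v); s (ordS (t.1 v))]| == 2%N.
    by rewrite cards2 (inj_eq is_) (eq_sym (t.1 v)) ordS_neq // ltnW.
  pose e : edge n := exist (fun e : {set 'I_n} => #|e| == 2%N) _ e2.
  apply/existsP; exists e; rewrite eqxx andbT.
  by have /andP[] := hit _ (edge_s e (t.1 v) (erefl _)).
- rewrite /vertex_colored; apply/eqP; rewrite x_map -map_comp -[RHS]map_tnth_enum.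
  by apply: eq_map => j /=; rewrite -cr f_invF.
apply/dinjectiveP => e e'; rewrite !inE => /existsP[v /andP[_ /eqP ev]] /existsP[v' /andP[_ /eqP ev']].
rewrite -(invF_f ir v) -/s next_s in ev; rewrite -(invF_f ir v') -/s next_s in ev'.
have /andP[_ /eqP ->] := hit _ (edge_s e _ ev).
have /andP[_ /eqP ->] := hit _ (edge_s e' _ ev') => /ig vv'.
by apply: val_inj; rewrite ev ev' vv'.
Qed.

End HamiltonHypergraph.

(** * Spread of the rainbow Hamilton cycles *)

Section TemplatesSpread.

Variables (R : realType) (n k q : nat) (c : 'I_n -> 'I_k) (cs : n.-tuple 'I_k).
Variable delta : R.
Hypotheses (n_gt2 : (2 < n)%N) (q_gt0 : (0 < q)%N) (delta_gt0 : 0 < delta).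
Hypothesis class_gt0 : forall v, (0 < class_size (tnth cs) (c v))%N.
Hypothesis delta_le :
  forall v, delta <= (class_size (tnth cs) (c v))%:R / expR 1 / 2.
Hypothesis delta_small : delta / expR 1 <= 2 ^+ n.

Let neighbours (j : 'I_n) : {set 'I_n} := [set ordS j; ord_pred j].

Lemma class_size_colors : class_size (fun _ : 'I_q => tt) tt = q.
Proof.
by rewrite /class_size -[RHS]card_ord -cardsT; apply: eq_card => i; rewrite !inE.
Qed.

(** Once [r] is known, the position of the edge at each [v] in [P] is determined, so the palette is
    prescribed at [#|P|] distinct positions. *)
Lemma card_matching_palettes (P : {set 'I_n}) (h : 'I_n -> 'I_q)
    (r f : 'I_n -> 'I_n) : {in P &, injective h} ->
  #|[set g in palettes n q | [forall v in P,
      [exists j, ([set r v; r (f v)] == [set j; ordS j]) && (g j == h v)]]]|%:R *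
    (q%:R / expR 1) ^+ #|P| <= #|palettes n q|%:R :> R.
Proof.
move=> h_inj; set G := [set g in _ | _].
have [->|[g0 g0G]] := set_0Vmem G; first by rewrite cards0 mul0r.
(* The default [v] is not reached for [v] in [P], since [g0] witnesses a position. *)
pose pos v := odflt v [pick j | [set r v; r (f v)] == [set j; ordS j]].
have posP g v : g \in G -> v \in P -> g (pos v) = h v.
  rewrite inE => /andP[_ /forallP gP] vP.
  have /existsP[j /andP[/eqP vj /eqP <-]] := implyP (gP v) vP.
  rewrite /pos; case: pickP => [j' /eqP vj'|none] /=.
    by congr (g _); apply: ordS_pair_inj; rewrite // -vj -vj'.
  by have := none j; rewrite vj eqxx.
have pos_inj : {in P &, injective pos}.
  move=> v v' vP v'P eq; apply: h_inj => //.
  by rewrite -(posP g0) // -(posP g0 v') // eq.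
pose l := [seq pos v | v <- enum P].
have ul : uniq l.
  by rewrite map_inj_in_uniq ?enum_uniq // => v v'; rewrite !mem_enum; apply: pos_inj.
have := card_prescribed R (fun _ : 'I_n => tt) (fun _ : 'I_q => tt) g0 ul.
rewrite big_map class_size_colors big_enum /= prodr_const; apply: le_trans.
rewrite ler_wpM2r ?exprn_ge0 ?divr_ge0 ?expR_ge0 // ler_nat subset_leq_card //.
apply/subsetP => g gG; rewrite inE; apply/andP; split.
  by move: gG; rewrite inE => /andP[].
by apply/allP => j /mapP[v]; rewrite mem_enum => vP ->; rewrite !posP.
Qed.

Lemma pair_neighbours (a b j : 'I_n) :
  a != b -> [set a; b] = [set j; ordS j] -> b \in neighbours a.
Proof.
move=> ab /setP eq; rewrite !inE.
have := eq a; have := eq b; rewrite !inE !eqxx orbT /=.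
move=> /esym/orP[/eqP bj|/eqP bj] /esym/orP[/eqP aj|/eqP aj].
- by rewrite aj bj eqxx in ab.
- by rewrite bj aj ordSK eqxx orbT.
- by rewrite bj aj eqxx.
by rewrite aj bj eqxx in ab.
Qed.

Lemma neighbours_le2 j : (#|neighbours j| <= 2)%N.
Proof. by rewrite cards2; case: (_ != _). Qed.

(** Conjugate to the rotation of the positions, hence a single cycle through all vertices. *)
Lemma conj_ordS_cycle (r : {ffun 'I_n -> 'I_n}) (ir : injective r) v :
  uniq (traject (fun v => invF ir (ordS (r v))) v #|'I_n|).
Proof.
have iterE i : iter i (fun v => invF ir (ordS (r v))) v = invF ir (iter i (@ordS n) (r v)).
  elim: i => [|i IHi] /=; first by rewrite invF_f.
  by rewrite IHi f_invF.
rewrite card_ord; apply/(uniqP v) => i j; rewrite !inE size_traject => ltin ltjn.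
rewrite !nth_traject // !iterE => /(congr1 r); rewrite !f_invF.
move=> /(congr1 val); rewrite /= !val_iter_ordS => /eqP.
by rewrite eqn_modDl !modn_small // => /eqP.
Qed.

(** A reference template containing [U] is fixed. Any other one must send [v] and [f v], for [v] in
    [P], to cyclically adjacent positions, which bounds the placements; given the placement, [#|U|]
    values of the palette are forced. *)
Theorem templates_spread :
  spread #|templates q c cs|%:R (delta / expR 1 / 2 * (q%:R / expR 1))
    (@colored_cycle n q) (templates q c cs).
Proof.
move=> U; set S := [set t in _ | _].
have kappa_gt0 : 0 < delta / expR 1 / 2 * (q%:R / expR 1) :> R.
  by rewrite mulr_gt0 ?divr_gt0 ?expR_gt0 ?ltr0n.
rewrite exprVn ler_pdivlMr ?exprn_gt0 //.
have [->|[[r0 g0] /setIdP[tT /subsetP U0]]] := set_0Vmem S.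
  by rewrite cards0 mul0r.
have /templatesP[/= ir0 cr0 ig0] := tT.
(* Successor of [v] on the reference cycle, and color of the edge joining them. *)
pose f v := invF ir0 (ordS (r0 v)); pose h v := g0 (r0 v).
have h_inj : injective h by move=> v v' /ig0/ir0.
(* The vertices whose outgoing reference edge lies in [U], recognized by its color because the
   reference cycle is rainbow. *)
pose P := h @^-1: (snd @: U).
have cardP : #|P| = #|U|.
  have <- : #|snd @: U| = #|U|.
    by apply: card_in_imset => u u' /U0 uH /U0 u'H; apply: (colored_cycle_color_inj tT).
  rewrite -(card_imset _ h_inj); apply: eq_card => i; apply/imsetP/idP.
    by move=> [v]; rewrite inE => vP ->.
  move=> iU; have /imsetP[u /U0/colored_cycleP[j /= _ ju] iu] := iU.
  exists (invF ir0 j); last by rewrite /h f_invF ju iu.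
  by rewrite inE /h f_invF ju -iu.
have P_edge v : v \in P -> exists2 u, u \in U & val u.1 = [set v; f v] /\ u.2 = h v.
  rewrite inE => /imsetP[u uU hu]; exists u => //; split=> //.
  have /colored_cycleP[/= j uj ju] := U0 u uU.
  have jv : j = r0 v by apply: ig0; rewrite ju -hu.
  by apply: (imset_inj ir0); rewrite uj jv imsetU1 imset_set1 f_invF.
have match_ t : t \in S -> forall v, v \in P ->
    exists2 j, [set t.1 v; t.1 (f v)] = [set j; ordS j] & t.2 j = h v.
  move=> /setIdP[_ /subsetP Ut] v /P_edge[u /Ut/colored_cycleP[j uj ju] [uv uh]].
  exists j; last by rewrite ju.
  by rewrite -uj uv imsetU1 imset_set1.
have f_inj : injective f by move=> v v' /(congr1 r0); rewrite !f_invF => /ordS_inj/ir0.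
have f_neq v : v != f v.
  by apply/eqP => /(congr1 r0); rewrite f_invF => /esym/eqP; rewrite (negbTE (ordS_neq _ (ltnW n_gt2))).
pose C := cyclic_adjacent c (tnth cs) f neighbours P.
have cardS : (#|S| <= \sum_(r in C) #|[set g in palettes n q | [forall v in P,
      [exists j, ([set r v; r (f v)] == [set j; ordS j]) && (g j == h v)]]]|)%N.
  rewrite -sum1_card (partition_big (fun t : template n q => t.1) (mem C)) /=; last first.
    move=> t tS; have /templatesP[it ct _] : t \in templates q c cs.
      by case/setIdP: tS.
    rewrite inE; apply/andP; split; first by apply/colored_injP.
    apply/forallP => v; apply/implyP => vP; have [j vj _] := match_ t tS v vP.
    by apply: pair_neighbours vj; rewrite (inj_eq it) f_neq.
  apply: leq_sum => r rC; rewrite sum1_card.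
  rewrite -(card_in_imset (f := snd)); last first.
    by move=> [r1 g1] [r2 g2] /andP[_ /eqP /= ->] /andP[_ /eqP /= ->] /= ->.
  apply: subset_leq_card; apply/subsetP => g /imsetP[[r' g']].
  rewrite unfold_in => /andP[tS /eqP /= r'r] ->; rewrite r'r in tS.
  rewrite inE; apply/andP; split.
    by case/setIdP: tS; rewrite in_setX => /andP[].
  apply/forallP => v; apply/implyP => vP; have [j vj jh] := match_ _ tS v vP.
  by apply/existsP; exists j; rewrite vj jh !eqxx.
rewrite -cardP exprMn.
have e0 : 0 <= (delta / expR 1 / 2) ^+ #|P| by rewrite exprn_ge0 // !divr_ge0 ?expR_ge0 // ltW.
have q0 : 0 <= (q%:R / expR 1) ^+ #|P| :> R by rewrite exprn_ge0 // divr_ge0 ?expR_ge0.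
apply: (@le_trans _ _ (#|C|%:R * (delta / expR 1 / 2) ^+ #|P| * #|palettes n q|%:R)).
  apply: (@le_trans _ _ ((\sum_(r in C) #|[set g in palettes n q | [forall v in P,
      [exists j, ([set r v; r (f v)] == [set j; ordS j]) && (g j == h v)]]]|%:R) *
      ((delta / expR 1 / 2) ^+ #|P| * (q%:R / expR 1) ^+ #|P|))).
    by rewrite ler_wpM2r ?mulr_ge0 // -natr_sum ler_nat.
  rewrite [leLHS]mulrCA -[leRHS]mulrA [leRHS]mulrCA ler_wpM2l // mulr_suml.
  rewrite [leRHS]mulr_natl -sumr_const; apply: ler_sum => r _.
  by apply: card_matching_palettes => v v' _ _; apply: h_inj.
rewrite cardsX natrM ler_wpM2r //.
apply: (card_cyclic_adjacent f_inj neighbours_le2 class_gt0 (ltW delta_gt0) delta_le).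
- exact: conj_ordS_cycle.
- by rewrite card_ord.
by rewrite card_ord ltnW // ltnW.
Qed.

End TemplatesSpread.

(** * Conclusion *)

Section CountingColors.

Variables (n k : nat) (c : 'I_n -> 'I_k) (cs : n.-tuple 'I_k).

Lemma card_color_count (d : 'I_n -> 'I_k) (j : 'I_k) :
  #|[set v | d v == j]| = count_mem j (map d (enum 'I_n)).
Proof. by rewrite count_map cardsE cardE enumT /enum_mem size_filter; apply: eq_count. Qed.

Lemma class_size_tnth (j : 'I_k) : class_size (tnth cs) j = count_mem j cs.
Proof. by rewrite /class_size card_color_count map_tnth_enum. Qed.

(** Equal color multiplicities give a color-preserving permutation. Nonemptiness later allows
    division by the number of templates. *)
Lemma templates_gt0 (q : nat) :
  (forall j, #|[set v | c v == j]| = count_mem j cs) -> (n <= q)%N ->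
  (0 < #|templates q c cs|)%N.
Proof.
move=> cE nq; rewrite cardsX muln_gt0; apply/andP; split; apply/card_gt0P.
  have /tuple_permP[s cs_s] : perm_eq (map c (enum 'I_n)) cs.
    by apply/allP => j _ /=; rewrite -cE card_color_count.
  exists [ffun v => s v]; apply/colored_injP; split.
    by move=> v v'; rewrite !ffunE => /perm_inj.
  move=> v; rewrite ffunE.
  have := congr1 (fun t => nth (c v) t v) cs_s.
  rewrite (nth_map v) ?size_enum_ord // nth_ord_enum => ->.
  by rewrite -tnth_nth tnth_mktuple.
exists [ffun j => widen_ord nq j]; apply/colored_injP; split=> // i j.
by rewrite !ffunE => /(congr1 val) /= /val_inj.
Qed.

End CountingColors.

Lemma outcome_law_ge0 (R : realType) (n q : nat) (p : R) (w : outcome n q) :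
  0 <= p <= 1 -> 0 <= gnp_law p w.1 * coloring_law R w.2.
Proof.
move=> p01; apply: mulr_ge0; first exact: (subset_law_ge0 _ p01).
by apply: prodr_ge0 => e _; rewrite invr_ge0.
Qed.

Lemma Pr_le1 (R : realType) (n q : nat) (p : R) (A : pred (outcome n q)) :
  0 <= p <= 1 -> (0 < q)%N -> Pr p A <= 1.
Proof.
move=> p01 q0.
have law_ge0 := fun w : outcome n q => outcome_law_ge0 w p01.
apply: (@le_trans _ _ (\sum_(w : outcome n q) gnp_law p w.1 * coloring_law R w.2)).
  by rewrite /Pr big_mkcond; apply: ler_sum => w _; case: ifP.
rewrite -(pair_bigA _ (fun E f => gnp_law p E * coloring_law R f)) /=.
under eq_bigr do rewrite -mulr_sumr.
rewrite -mulr_suml (sum_subset_law (edge n) p) mul1r.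
rewrite -(bigA_distr_bigA (fun (_ : edge n) (_ : 'I_q) => q%:R^-1)) /= big1 // => e _.
by rewrite sumr_const card_ord -[LHS]mulr_natl divff // pnatr_eq0 -lt0n.
Qed.

(** The spread lemma is run on pairs at density [p / q]. As [kappa] is proportional to [q], the
    condition on [p] is free of [q]. *)
Lemma Pr_colored_rainbow_ge (R : realType) (n k q : nat) (c : 'I_n -> 'I_k)
    (cs : n.-tuple 'I_k) (delta p L : R) (m j : nat) :
  (2 < n)%N -> (0 < q)%N -> 0 < delta ->
  (forall v, 0 < class_size (tnth cs) (c v))%N ->
  (forall v, delta <= (class_size (tnth cs) (c v))%:R / expR 1 / 2) ->
  delta / expR 1 <= 2 ^+ n -> (0 < #|templates q c cs|)%N ->
  0 <= p <= 1 -> 1 <= L -> (n < 2 ^ j)%N ->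
  (16 * j%:R + L) * (2 * expR 1 ^+ 2) / delta <= p ->
  1 - (2 ^+ m / L + 2^-1 ^+ m) <=
    Pr p (@has_colored_rainbow_hamilton n k q c cs).
Proof.
move=> n2 q0 delta0 class0 delta_le delta_small T0 p01 L1 nj pj.
have /andP[p_ge0 p_le1] := p01.
have q0R : 0 < q%:R :> R by rewrite ltr0n.
have e0 : 0 < expR 1 :> R by rewrite expR_gt0.
pose kappa : R := delta / expR 1 / 2 * (q%:R / expR 1).
have kappa0 : 0 < kappa by rewrite mulr_gt0 ?divr_gt0.
have pq1 : p / q%:R <= 1 by rewrite ler_pdivrMr // mul1r (le_trans p_le1) // ler1n.
have pqj : (16 * j%:R + L) / kappa <= p / q%:R.
  rewrite ler_pdivlMr //; apply: le_trans pj; rewrite le_eqVlt; apply/orP; left.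
  by apply/eqP; rewrite /kappa; field; rewrite ?gt_eqF.
have := spread_lemma m (ler0n R _) kappa0 L1
  (templates_spread n2 q0 delta0 class0 delta_le delta_small)
  (fun t => @card_colored_cycle _ _ _ c cs t) nj pq1 pqj.
rewrite -[X in X <= _]mulr1 ler_pM2l ?ltr0n // => hit.
rewrite lerBlDr; apply: le_trans hit _; apply: lerD; last first.
  rewrite /spread_loss lerD2l; case: ifP => _; last by rewrite exprn_ge0 // invr_ge0.
  by rewrite lerBlDr lerDl exprn_ge0 // invr_ge0.
have q0' : (0 < #|'I_q|)%N by rewrite card_ord.
have := independent_le_exclusive (colored_cycle_functional n2) p01 q0'.
rewrite card_ord => /(_ k c cs)/le_trans; apply.
rewrite /Pr [leRHS]big_mkcond; apply: ler_sum => w _.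
have law0 := outcome_law_ge0 w p01.
case: (boolP [exists t in _, _]) => [/existsP[t /andP[tT /forallP ht]]|_]; last first.
  by rewrite mulr0; case: ifP.
rewrite (_ : has_colored_rainbow_hamilton c cs w) ?mulr1 //.
by apply: (colored_cycle_hits n2 tT) => u; apply/implyP.
Qed.

(** * Elementary estimates for the logarithm *)

Lemma expR_half_le2 (R : realType) : expR (2^-1) <= 2 :> R.
Proof.
have := expR_ge1Dx (- 2^-1 : R); rewrite expRN => h.
have {h} : 2^-1 <= (expR 2^-1)^-1 :> R by apply: le_trans h; lra.
by rewrite lef_pV2 ?posrE ?expR_gt0.
Qed.

Lemma trunc_log2_le_ln (R : realType) (n : nat) : (0 < n)%N ->
  (trunc_log 2 n)%:R <= 2 * ln n%:R :> R.
Proof.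
move=> n0; rewrite mulrC -ler_pdivrMr //.
rewrite -[leLHS]expRK ler_ln ?posrE ?expR_gt0 ?ltr0n // expRM_natl.
apply: le_trans (_ : 2 ^+ trunc_log 2 n <= _).
  by rewrite lerXn2r ?nnegrE ?expR_ge0 ?expR_half_le2.
by rewrite -natrX ler_nat trunc_logP.
Qed.

(** With [s] the square root of [n]: [ln n = 2 * ln s], [ln s < s] and [2 * K <= s]. *)
Lemma ln_le_natr (R : realType) (K : R) (n : nat) : 0 <= K ->
  4 * K ^+ 2 <= n%:R -> K * ln n%:R <= n%:R.
Proof.
move=> K0 Kn; case: n Kn => [|n] Kn; first by rewrite ln0 ?mulr0.
have n0 : 0 < n.+1%:R :> R by rewrite ltr0n.
pose s := Num.sqrt (n.+1%:R : R).
have s0 : 0 < s by rewrite sqrtr_gt0.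
have s2 : s ^+ 2 = n.+1%:R by rewrite sqr_sqrtr // ltW.
have Ks : 2 * K <= s.
  rewrite -(@ler_pXn2r _ 2) ?nnegrE ?(ltW s0) ?mulr_ge0 // s2 exprMn.
  by have -> : 2 ^+ 2 = 4 :> R by ring.
rewrite -s2 lnXn // -mulr_natl; have := ltW (ln_sublinear s0) => ls.
have : 2 * K * ln s <= 2 * K * s by rewrite ler_wpM2l // mulr_ge0.
have : 2 * K * s <= s * s by rewrite ler_wpM2r // ltW.
rewrite expr2; lra.
Qed.

Lemma exists_lower_bound (R : realFieldType) (k : nat) (beta : 'I_k -> R) :
  (forall i, 0 < beta i) ->
  exists b, [/\ 0 < b, b <= 1 & forall i, b <= beta i].
Proof.
move=> beta0; exists (\big[Num.min/1]_i beta i); split.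
- by elim/big_ind: _ => // x y x0 y0; rewrite lt_min x0.
- exact: bigmin_le_id.
by move=> i; apply: bigmin_le.
Qed.

Theorem theorem3 (R : realType) (k : nat) (hk : (1 <= k)%N)
    (beta : 'I_k -> R) (beta_gt0 : forall i : 'I_k, 0 < beta i)
    (beta_sum : \sum_(i < k) beta i = 1) :
  exists2 K : R, 0 < K &
    forall eps : R, 0 < eps ->
    exists N : nat, forall n : nat, (N <= n)%N ->
    forall (c : 'I_n -> 'I_k) (cs : n.-tuple 'I_k) (q : nat),
      (forall i : 'I_k, #|[set v : 'I_n | c v == i]|%:R = beta i * n%:R) ->
      (forall j : 'I_k, (count_mem j cs)%:R = beta j * n%:R) ->
      (n <= q)%N ->
      `|Pr (K * ln n%:R / n%:R) (@has_colored_rainbow_hamilton n k q c cs) - 1|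
        < eps.
Proof.
have [b [b0 b1 b_le]] := exists_lower_bound beta_gt0.
have e0 : 0 < expR 1 :> R by rewrite expR_gt0.
have e1 : 1 <= expR 1 :> R by rewrite ltW // expR_gt1.
(* The second factor is [2 * expR 1 ^+ 2 * n / delta] for the [delta] below. The 49 is
   [32 + 16 + 1]: the base 2 logarithm is at most [2 * ln n], one more round costs 16, [L] is
   [ln n], and [1 <= ln n]. *)
pose K : R := 49 * (4 * expR 1 ^+ 3 / b).
have K0 : 0 < K by rewrite mulr_gt0 ?divr_gt0 ?mulr_gt0 ?exprn_gt0.
exists K => // eps eps0.
pose m := Num.bound (2 / eps).
have m_eps : 2^-1 ^+ m < eps / 2.
  rewrite exprVn invf_plt ?posrE ?exprn_gt0 ?divr_gt0 // invf_div.
  apply: lt_le_trans (archi_boundP _) _; first by rewrite divr_ge0 // ltW.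
  by rewrite -natrX ler_nat ltnW // ltn_expl.
(* Half of [eps] goes to [2^-1 ^+ m], the other half to [2 ^+ m / ln n] once [L0 <= ln n]. *)
pose L0 : R := 1 + 2 ^+ m / (eps / 2).
have L01 : 1 <= L0 by rewrite lerDl divr_ge0 ?exprn_ge0 // ltW // divr_gt0.
(* The three terms give [L0 <= ln n], [p <= 1] and [2 < n]. *)
exists (Num.bound (expR L0) + Num.bound (4 * K ^+ 2) + 3)%N => n nN c cs q cE csE nq.
have n2 : (2 < n)%N by apply: leq_trans nN; rewrite addn3 !ltnS.
have n0 : (0 < n)%N by apply: ltn_trans n2.
have n0R : 0 < n%:R :> R by rewrite ltr0n.
have bound_le x : 0 <= x -> (Num.bound x <= n)%N -> x <= n%:R :> R.
  by move=> x0 xn; apply: le_trans (ltW (archi_boundP x0)) _; rewrite ler_nat.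
have lnL0 : L0 <= ln n%:R.
  rewrite -[L0]expRK ler_ln ?posrE ?expR_gt0 //; apply: bound_le; rewrite ?expR_ge0 //.
  by apply: leq_trans nN; rewrite -addnA leq_addr.
have Kn : 4 * K ^+ 2 <= n%:R.
  apply: bound_le; first by rewrite mulr_ge0 ?exprn_ge0 // ltW.
  by apply: leq_trans nN; rewrite addnAC leq_addl.
have ln1 : 1 <= ln n%:R :> R by apply: le_trans lnL0.
set p := K * ln n%:R / n%:R.
have p01 : 0 <= p <= 1.
  apply/andP; split; last by rewrite ler_pdivrMr // mul1r ln_le_natr // ltW.
  by apply: divr_ge0 => //; apply: mulr_ge0; [exact: ltW | exact: le_trans ln1].
have q0 : (0 < q)%N by apply: leq_trans nq.
pose delta : R := b * n%:R / expR 1 / 2.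
have delta0 : 0 < delta by rewrite !divr_gt0 ?mulr_gt0.
have classE v : (class_size (tnth cs) (c v))%:R = beta (c v) * n%:R.
  by rewrite class_size_tnth csE.
have class0 v : (0 < class_size (tnth cs) (c v))%N.
  by rewrite -(ltr0n R) classE mulr_gt0.
have delta_le v : delta <= (class_size (tnth cs) (c v))%:R / expR 1 / 2.
  rewrite classE /delta !ler_wpM2r ?invr_ge0 ?(ltW e0) ?(ltW n0R) //.
have delta_small : delta / expR 1 <= 2 ^+ n.
  apply: le_trans (_ : n%:R <= _); last by rewrite -natrX ler_nat ltnW // ltn_expl.
  rewrite /delta !ler_pdivrMr //.
  have ee : 1 <= expR 1 * 2 * expR 1 :> R.
    by rewrite !mulr_ege1 ?ler1n.
  rewrite -!mulrA [b * _]mulrC ler_wpM2l ?(ltW n0R) //.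
  apply: le_trans b1 _; apply: le_trans ee _.
  by rewrite le_eqVlt; apply/orP; left; apply/eqP; ring.
have T0 : (0 < #|templates q c cs|)%N.
  apply: templates_gt0 nq => j; apply/eqP; rewrite -(eqr_nat R); apply/eqP.
  by rewrite cE csE.
have n_lt : (n < 2 ^ (trunc_log 2 n).+1)%N by apply: trunc_log_ltn.
have pj : (16 * (trunc_log 2 n).+1%:R + ln n%:R) * (2 * expR 1 ^+ 2) / delta <= p.
  have -> : p = 49 * ln n%:R * (2 * expR 1 ^+ 2) / delta.
    by rewrite /p /K /delta; field; rewrite ?gt_eqF.
  rewrite ler_wpM2r ?invr_ge0 ?(ltW delta0) // ler_wpM2r ?mulr_ge0 ?exprn_ge0 ?(ltW e0) //.
  rewrite -natr1; have := trunc_log2_le_ln R n0; lra.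
have := Pr_colored_rainbow_ge m n2 q0 delta0 class0 delta_le delta_small T0 p01 ln1 n_lt pj.
have Pr1 := Pr_le1 (@has_colored_rainbow_hamilton n k q c cs) p01 q0.
have : 2 ^+ m / ln n%:R <= eps / 2.
  rewrite ler_pdivrMr ?(lt_le_trans ltr01 ln1) // mulrC -ler_pdivrMr ?divr_gt0 //.
  by apply: le_trans lnL0; rewrite lerDr.
rewrite distrC ger0_norm ?subr_ge0 //; lra.
Qed.
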